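(* Let $p\ge 1$ be a real number. Let $H$ be a finitely generated amenable group and let $S_H$ be a finite generating set of $H$. Let $\mathscr{L}H$ be a naturally generated halo product over $H$. (i) If $\mathscr{L}H$ is large-scale commutative and has finitely generated blocks, then for any $s_0\in S_H$ there exists a constant $C>0$ such that $$\left(\text{Føl}_{L(\{1_H,s_0\})}(x)\right)^{C\,\text{Føl}_H(x)}\preccurlyeq \text{Føl}_{p,\mathscr{L}H}(x).$$ (ii) If $\mathscr{L}H$ has consistent blocks, then there exists a constant $C>0$ such that $$\text{Føl}_{p,\mathscr{L}H}(x)\preccurlyeq \text{Føl}_{p,H}(x)\cdot\Lambda_{\mathscr{L}H}\left(C\cdot \text{Føl}_{p,H}(x)\right),$$ where $\Lambda_{\mathscr{L}H}$ is the lamp growth sequence of $\mathscr{L}H$.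
   Context: Halo products: a halo of groups $\mathscr{L}$ over a set $X$ is the data, for each subset $S\subset X$, of a group $L(S)$ such that: $R\subset S$ implies $L(R)\leqslant L(S)$; $L(\emptyset)=\{1\}$ and $L(X)=\langle L(S): S\subset X\text{ finite}\rangle$; $L(R\cap S)=L(R)\cap L(S)$ for all $R,S\subset X$. Here $X=H$ with $H$ acting on itself by left multiplication; given a morphism $\alpha\colon H\to\mathrm{Aut}(L(H))$ with $\alpha(h)(L(S))=L(hS)$ for all $h\in H$, $S\subset H$, the halo product is $\mathscr{L}H=L(H)\rtimes_\alpha H$. Properties (with respect to the finite generating set $S_H$ and its word metric $d_{S_H}$): - $\mathscr{L}H$ is naturally generated if it is generated by $\{(1_{L(H)},s): s\in S_H\}\cup\bigcup_{s\in S_H}\{(\sigma,1_H):\sigma\in L(\{1_H,s\})\}$. - $\mathscr{L}H$ is large-scale commutative if there is $D\ge 0$ such that for all $R,S\subset H$ with $d_{S_H}(R,S)\ge D$, the subgroups $L(R)$ and $L(S)$ commute in $L(H)$. - $\mathscr{L}H$ has finite (resp. finitely generated) blocks if $L(S)$ is finite (resp. finitely generated) for every finite $S\subset H$. - $\mathscr{L}H$ has consistent blocks if it has finite blocks and for finite $S\subset H$ the cardinality $|L(S)|$ depends only on $|S|$. Its lamp growth sequence is then $\Lambda_{\mathscr{L}H}(n)=|L(S)|$ for any $S\subset H$ with $|S|=n$ (evaluated at integer parts for non-integer arguments). Følner functions: for a finitely generated group $G$ with finite generating set $S_G$, $\text{Føl}_{p,G}(x)=\inf\{|\mathrm{supp}\,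 f| : \|\nabla f\|_p/\|f\|_p\le 1/x\}$ over nonzero finitely supported $f\colon G\to\mathbb{R}_+$, where $\|\nabla f\|_p^p=\sum_{g\in G,\,s\in S_G}|f(g)-f(gs)|^p$; and $\text{Føl}_G(x)=\inf\{|A| : |\partial_G A|/|A|\le 1/x\}$ over nonempty finite $A\subset G$, where $\partial_G A=AS_G\setminus A$. One has $\text{Føl}_{1,G}\simeq\text{Føl}_G$, and up to $\simeq$ these do not depend on $S_G$. Asymptotic comparison: for non-decreasing functions, $f\preccurlyeq g$ means that there is $C>0$ such that $f(x)=O(g(Cx))$ as $x\to+\infty$; $f\simeq g$ means $f\preccurlyeq g$ and $g\preccurlyeq f$. *)

(* Defs.v *)
From HB Require Import structures.
From mathcomp Require Import all_boot all_order all_algebra finmap.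
From mathcomp Require Import all_classical all_reals all_analysis.

Set Implicit Arguments.
Unset Strict Implicit.
Unset Printing Implicit Defensive.

Import Order.TTheory GRing.Theory Num.Theory.
Import numFieldNormedType.Exports.

Local Open Scope classical_set_scope.
Local Open Scope ring_scope.

Record subgroup (G : groupType) := Subgroup {
  subgroup_set :> set G;
  subgroupP : group_closed (fun x : G => x \in subgroup_set) }.

Definition subgroup_sort (G : groupType) (K : subgroup G) : Type :=
  {x : G | x \in subgroup_set K}.

Section SubgroupGroup.
Variables (G : groupType) (K : subgroup G).
HB.instance Definition _ := SubChoice.on (subgroup_sort K).
HB.instance Definition _ :=
  @SubChoice_isSubGroup.Build G _ (subgroup_sort K) (subgroupP K).
End SubgroupGroup.

Definition subgroup_group (G : groupType) (K : subgroup G) : groupType :=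
  subgroup_sort K.

Definition generated (G : groupType) (B : set G) : set G :=
  smallest (fun K : set G => group_closed (fun x : G => x \in K)) B.

(* Finite generating sets generate as a group and need not be symmetric. *)
Definition generates (G : groupType) (S : {fset G}) : Prop :=
  generated [set` S] = [set: G].

Section Metric.
Context (R : realType) (G : groupType).
Implicit Types S : {fset G}.

(* Left-invariant word metric, i.e. the path metric on the Cayley graph whose
   edges join g to gs; it is +oo if no word exists. *)
Definition word_dist S (g h : G) : \bar R :=
  ereal_inf [set (size w)%:R%:E | w in [set w : seq G |
    all (fun s => (s \in S) || (s^-1%g \in S)) w /\
    (\prod_(s <- w) s)%g = (g^-1 * h)%g]].

Definition set_dist S (A B : set G) : \bar R :=
  ereal_inf [set word_dist S ab.1 ab.2 | ab in A `*` B].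

End Metric.

Section Folner.
Context (R : realType) (G : groupType).
Implicit Types (S A : {fset G}) (x p : R).

Definition boundary S A : {fset G} := ([fset (a * s)%g | a in A, s in S] `\` A)%fset.

Definition Folner S x : \bar R :=
  ereal_inf [set (#|` A|)%:R%:E | A in [set A : {fset G} |
    A != fset0%fset /\ (#|` boundary S A|)%:R / (#|` A|)%:R <= 1 / x :> R]].

(* For f finitely supported and p > 0 the summands below vanish outside of a
   finite set, so that both sums are genuine. *)
Definition lp_norm p (f : G -> R) : R :=
  (\sum_(g \in [set: G]) `|f g| `^ p) `^ p^-1.

Definition lp_grad S p (f : G -> R) : R :=
  (\sum_(g \in [set: G]) \sum_(s <- S) `|f g - f (g * s)%g| `^ p) `^ p^-1.

Definition Folnerp p S x : \bar R :=
  ereal_inf [set (#|` finsupp f|)%:R%:E | f in [set f : {fsfun G -> R with 0} |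
    [/\ forall g, 0 <= f g, finsupp f != fset0%fset &
        lp_grad S p f / lp_norm p f <= 1 / x]]].

(* Følner's condition. *)
Definition amenable : Prop :=
  forall S (e : R), 0 < e -> exists A : {fset G},
    A != fset0%fset /\ (#|` boundary S A|)%:R <= e * (#|` A|)%:R.

End Folner.

(* f(x) = O(g(Cx)) as x tends to +oo, for functions with values in [0, +oo]. *)
Definition asymp_le (R : realType) (f g : R -> \bar R) : Prop :=
  exists2 C : R, 0 < C & exists2 M : R, 0 < M &
    \forall x \near +oo, (f x <= M%:E * g (C * x)%R)%E.

Record is_halo (X : Type) (A : groupType) (L : set X -> subgroup A) : Prop :=
  IsHalo {
  halo_mono : forall S T : set X, S `<=` T -> L S `<=` L T;
  halo0 : L set0 = [set 1%g] :> set A;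
  halo_gen : L [set: X] =
    generated (\bigcup_(S in [set S : set X | finite_set S]) L S) :> set A;
  haloI : forall S T : set X, L (S `&` T) = L S `&` L T :> set A }.

(* A morphism from H to Aut(A): an action of H on A by group morphisms, which
   are bijective by the last two fields. *)
Record aut_action (H A : groupType) := AutAction {
  aut_act :> H -> A -> A;
  aut_actM : forall h, {morph aut_act h : x y / (x * y)%g};
  aut_act1 : forall x, aut_act 1%g x = x;
  aut_act_comp : forall g h x, aut_act (g * h)%g x = aut_act g (aut_act h x) }.

Definition semidirect (A H : groupType) (a : aut_action H A) : Type :=
  (A * H)%type.

Section Semidirect.
Variables (A H : groupType) (a : aut_action H A).

HB.instance Definition _ := Choice.copy (semidirect a) (A * H)%type.

Definition sd_one : semidirect a := (1%g, 1%g).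
Definition sd_mul (u v : semidirect a) : semidirect a :=
  ((u.1 * a u.2 v.1)%g, (u.2 * v.2)%g).
Definition sd_inv (u : semidirect a) : semidirect a :=
  (a u.2^-1%g u.1^-1%g, u.2^-1%g).

Lemma aut_act_one h : a h 1%g = 1%g.
Proof.
by apply: (mulgI (a h 1%g)); rewrite -aut_actM !mulg1.
Qed.

Lemma sd_mulA : associative sd_mul.
Proof.
move=> u v w; rewrite /sd_mul /=; congr (_, _); last exact: mulgA.
by rewrite aut_actM aut_act_comp mulgA.
Qed.

Lemma sd_mul1 : left_id sd_one sd_mul.
Proof. by case=> x h; rewrite /sd_mul /= aut_act1 !mul1g. Qed.

Lemma sd_1mul : right_id sd_one sd_mul.
Proof. by case=> x h; rewrite /sd_mul /= aut_act_one !mulg1. Qed.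

Lemma sd_mulV : left_inverse sd_one sd_inv sd_mul.
Proof.
by case=> x h; rewrite /sd_mul /sd_inv /= -aut_actM !mulVg aut_act_one.
Qed.

Lemma sd_Vmul : right_inverse sd_one sd_inv sd_mul.
Proof.
by case=> x h; rewrite /sd_mul /sd_inv /= -aut_act_comp !mulgV aut_act1 mulgV.
Qed.

HB.instance Definition _ :=
  isGroup.Build (semidirect a) sd_mulA sd_mul1 sd_1mul sd_mulV sd_Vmul.

End Semidirect.

(* [lamps] plays the role of L(H), whence [blockT]. *)
Record halo_product (H : groupType) := HaloProduct {
  lamps : groupType;
  block : set H -> subgroup lamps;
  block_halo : is_halo block;
  blockT : block [set: H] = [set: lamps] :> set lamps;
  lamps_act : aut_action H lamps;
  lamps_act_block : forall (h : H) (S : set H),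
    lamps_act h @` block S = block [set (h * k)%g | k in S] :> set lamps }.

Definition halo_group (H : groupType) (L : halo_product H) : groupType :=
  semidirect (lamps_act L).
Coercion halo_group : halo_product >-> groupType.

Section HaloProperties.
Context (H : groupType) (L : halo_product H).
Implicit Types S : {fset H}.

Definition natural_generators S : set L :=
  [set (1%g, s) | s in [set` S]] `|`
  \bigcup_(s in [set` S]) [set (x, 1%g) | x in block L [set 1%g; s]].

Definition naturally_generated S : Prop :=
  generated (natural_generators S) = [set: L].

Definition large_scale_commutative (R : realType) S : Prop :=
  exists2 D : R, 0 <= D & forall A B : set H,
    (D%:E <= set_dist R S A B)%E ->
    forall x y,
      subgroup_set (block L A) x -> subgroup_set (block L B) y -> commute x y.

Definition finite_blocks : Prop :=
  forall S : set H, finite_set S -> finite_set (block L S).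

Definition finitely_generated_blocks : Prop :=
  forall S : set H, finite_set S ->
    exists T : {fset subgroup_group (block L S)}, generates T.

Definition block_card S : nat := #|` fset_set (block L [set` S])|.

Definition consistent_blocks : Prop :=
  finite_blocks /\
  forall S T : {fset H}, #|` S| = #|` T| -> block_card S = block_card T.

(* If H is finite, the values of the lamp growth sequence at n > |H| are not
   determined by this condition. *)
Definition lamp_growth (Lam : nat -> nat) : Prop :=
  forall S : {fset H}, block_card S = Lam #|` S|.

End HaloProperties.

(* Main.v *)
From HB Require Import structures.
From mathcomp Require Import all_boot all_order all_algebra finmap.
From mathcomp Require Import all_classical all_reals all_analysis.
From mathcomp Require Import zify ring lra.
Require Import Defs.

(** Write G = L(H) x| H. Both bounds compare energies
    E_u(f) = sum_g |f(g) - f(gu)|^p, and the energies of one generating set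
    control those of any other.

    Lower bound. From f one gets, by Bernoulli's inequality and the coarea
    formula, a finite set A of G inside the support of f with small boundary.
    The left cosets of H cut A into fibres and those of L({1, s0}) cut A into
    lines; most points of A lie on a Folner fibre, hence one of cardinality at
    least n = Fol_H(x), and on a Folner line, hence one of cardinality at least
    m = Fol_{L({1, s0})}(x). A minimality argument gives a nonempty B in A
    keeping a quarter of each fibre and a half of each line that it meets.
    Since L({h, h s0}) and L(H \ {h, h s0}) meet trivially, splitting B along a
    line in direction h multiplies cardinalities, so that
    m^n <= #|B|^24 by induction on the length of the fibres.

    Upper bound. A function f on H with support F is lifted to
    (x, h) |-> f(h) on L(F) x H; a lamp move in L({h, hs}) leaves the support only
    if h is in F and hs is not, and then f(h) = |f(h) - f(hs)|. *)

Import Order.TTheory GRing.Theory Num.Theory.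
Import numFieldNormedType.Exports.

Local Open Scope classical_set_scope.
Local Open Scope ring_scope.

(** * Change of generators *)

(** The sum is at most twice its larger term. No convexity enters, so every exponent [0 <= p] is
    allowed. *)
Lemma ler_powRD (R : realType) (p a b : R) : 0 <= p -> 0 <= a -> 0 <= b ->
  (a + b) `^ p <= 2 `^ p * (a `^ p + b `^ p).
Proof.
move=> p0 a0 b0; wlog ab : a b a0 b0 / a <= b.
  move=> W; have [/W|/ltW/W] := leP a b; first exact.
  by rewrite (addrC a) (addrC (a `^ p)); apply.
apply: (@le_trans _ _ ((2 * b) `^ p)).
  by rewrite ge0_ler_powR// ?nnegrE ?addr_ge0 ?mulr_ge0// mulr_natl mulr2n lerD2r.
rewrite powRM//.
by rewrite ler_pM2l ?powR_gt0//; have := powR_ge0 a p; lra.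
Qed.

Section Energy.
Context {R : realType} {G : groupType}.
Implicit Types (p : R) (f : G -> R) (u v g : G) (X : {fset G}).

Definition supported f X : Prop := forall g, g \notin X -> f g = 0.

Definition energy p u f : R :=
  \sum_(g \in [set: G]) `|f g - f (g * u)%g| `^ p.

Lemma fsbig_shift (F : G -> R) u :
  \sum_(g \in [set: G]) F (g * u)%g = \sum_(g \in [set: G]) F g.
Proof.
rewrite [RHS](reindex_fsbigT (fun g => (g * u)%g))//.
by exists (fun g => (g * u^-1)%g) => g /=; rewrite ?mulgK ?mulgVK.
Qed.

Definition energy_supp X u : {fset G} :=
  (X `|` [fset (g * u^-1)%g | g in X])%fset.

(** [energy_supp X u] is the set of g such that g or g u lies in X. The exponent must be nonzero
    because 0 to the power 0 is 1. *)
Lemma energy_term0 p u f X g : p != 0 -> supported f X ->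
  g \notin energy_supp X u -> `|f g - f (g * u)%g| `^ p = 0.
Proof.
move=> p0 fX; rewrite inE negb_or => /andP[gX guX].
rewrite (fX g)// (fX (g * u)%g) ?subr0 ?normr0 ?powR0//.
by apply: contra guX => guX; apply/imfsetP; exists (g * u)%g; rewrite //= mulgK.
Qed.

Lemma energyE p u f X Y : p != 0 -> supported f X ->
  (energy_supp X u `<=` Y)%fset ->
  energy p u f = \sum_(g <- Y) `|f g - f (g * u)%g| `^ p.
Proof.
move=> p0 fX /fsubsetP XY; apply: fsbigTE => g gY.
by apply: (energy_term0 _ _ _ X) => //; apply: contra gY => /XY.
Qed.

Lemma energy_ge0 p u f : 0 <= energy p u f.
Proof. by apply: fsumr_ge0 => g _; exact: powR_ge0. Qed.

Lemma energy1 p f : p != 0 -> energy p 1%g f = 0.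
Proof.
by move=> p0; apply: fsbig1 => g _; rewrite mulg1 subrr normr0 powR0.
Qed.

(** Go from g to g u v^-1 through g u. Shifting the sum of [energy p v f] by u v^-1 turns its terms
    into |f(g u v^-1) - f(g u)|^p, and [ler_powRD] concludes term by term. The quotient u / v is the
    operation under which [group_closed] asks for stability. *)
Lemma energy_div p u v f X : 0 < p -> supported f X ->
  energy p (u / v)%g f <= 2 `^ p * (energy p u f + energy p v f).
Proof.
move=> p0 fX; have pn0 : p != 0 by rewrite gt_eqF.
rewrite {3}/energy -(fsbig_shift _ (u / v)%g).
(* A common finite support for the three sums, the third one being shifted. *)
pose Y := (energy_supp X (u / v)%g `|` energy_supp X u
  `|` [fset (g * (u / v)^-1)%g | g in energy_supp X v])%fset.
rewrite (energyE p (u / v)%g f X Y)//; last by rewrite /Y -fsetUA fsubsetUl.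
rewrite (energyE p u f X Y)//; last first.
  by apply/fsubsetP => g gu; rewrite in_fsetU in_fsetU gu orbT.
rewrite (fsbigTE Y) => [|g gY]; last first.
  apply: (energy_term0 _ _ _ X) => //; apply: contra gY => gY.
  rewrite in_fsetU; apply/orP; right; apply/imfsetP.
  by exists (g * (u / v))%g; rewrite //= mulgK.
rewrite -big_split/= mulr_sumr; apply: ler_sum => g _.
have -> : (g * (u / v) * v = g * u)%g by rewrite -mulgA mulgVK.
apply: le_trans (ler_powRD _ _ _ _ (ltW p0) (normr_ge0 _) (normr_ge0 _)).
rewrite ge0_ler_powR ?(ltW p0) ?nnegrE ?addr_ge0//.
rewrite (distrC (f (g * (u / v))%g)) -(subrKA (f (g * u)%g)).
exact: ler_normD.
Qed.

(** The elements u whose energy is controlled in this way form a subgroup containing B, by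
    [energy_div]. The word w and the constant K do not depend on f. *)
Lemma energy_generated p (B : set G) u : 0 < p -> generated B u ->
  exists w : seq G, exists2 K : R, 0 <= K &
    (forall v, v \in w -> B v) /\
    forall f X, supported f X -> energy p u f <= K * \sum_(v <- w) energy p v f.
Proof.
move=> p0; pose good u := exists w : seq G, exists2 K : R, 0 <= K &
    (forall v, v \in w -> B v) /\
    forall f X, supported f X -> energy p u f <= K * \sum_(v <- w) energy p v f.
suff: generated B `<=` [set u | good u] by apply.
apply: smallest_sub => [|v Bv]; last first.
  exists [:: v], 1 => //; split; first by move=> ?; rewrite inE => /eqP->.
  by move=> f X _; rewrite big_seq1 mul1r.
split.
  rewrite inE; exists [::], 0 => //; split => // f X _.
  by rewrite big_nil mulr0 energy1// gt_eqF.
move=> {u}u v /[!inE] -[w1 [K1 K10 [B1 E1]]] [w2 [K2 K20 [B2 E2]]].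
exists (w1 ++ w2), (2 `^ p * (K1 + K2)); first by rewrite mulr_ge0 ?powR_ge0 ?addr_ge0.
split=> [t|f X fX]; first by rewrite mem_cat => /orP[/B1|/B2].
apply: (le_trans (energy_div _ _ _ _ _ p0 fX)).
rewrite big_cat/= -mulrA ler_pM2l ?powR_gt0//.
have := E1 _ _ fX; have := E2 _ _ fX.
have : 0 <= \sum_(v <- w1) energy p v f by rewrite sumr_ge0// => *; exact: energy_ge0.
have : 0 <= \sum_(v <- w2) energy p v f by rewrite sumr_ge0// => *; exact: energy_ge0.
nra.
Qed.

End Energy.

(** * From functions to sets *)

Lemma sum_fset_card (T : choiceType) (X : {fset T}) (P : pred T) :
  (\sum_(g <- X) P g)%N = #|` [fset g in X | P g]%fset|.
Proof.
rewrite card_fset_sum1 -big_fset_condE/= [RHS]big_mkcond/=.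
by apply: eq_bigr => g _; case: (P g).
Qed.

Lemma sumr_fset_card (R : realType) (T : choiceType) (X : {fset T}) (P : pred T) :
  \sum_(g <- X) (P g)%:R = #|` [fset g in X | P g]%fset|%:R :> R.
Proof. by rewrite -sum_fset_card natr_sum. Qed.

Lemma sum_le_fsbig (R : realType) (T : choiceType) (F : T -> R) (X Y : {fset T}) :
  (forall g, 0 <= F g) -> (forall g, g \notin Y -> F g = 0) ->
  \sum_(g <- X) F g <= \sum_(g \in [set: T]) F g.
Proof.
move=> F0 FY; rewrite (fsbigTE (X `|` Y)%fset) => [|g]; last first.
  by rewrite in_fsetU negb_or => /andP[_ /FY].
have XE : \sum_(g <- (X `|` Y)%fset | g \in X) F g = \sum_(g <- X) F g.
  rewrite big_fset_condE; apply: eq_fbigl => g.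
  by rewrite !inE; case: (g \in X); rewrite //= ?andbF.
by rewrite [leRHS](bigID (mem X))/= XE lerDl sumr_ge0.
Qed.

Section PowerDifference.
Context {R : realType}.
Implicit Types (p a b t y : R).

Lemma bernoulli_expr t k : 0 <= t <= 1 -> 1 - t ^+ k <= k%:R * (1 - t).
Proof.
move=> /andP[t0 t1]; elim: k => [|k IH]; first by rewrite expr0 subrr mul0r.
rewrite -natr1 exprS.
have : t * (1 - t ^+ k) <= 1 - t ^+ k.
  by rewrite ler_piMl// subr_ge0 exprn_ile1.
lra.
Qed.

(** A pointwise substitute for Hölder's inequality, with a free parameter y. With t = b / a and u =
    1 - t, Bernoulli gives 1 - t^p <= 1 - t^k <= k u. Moreover u <= y^(p-1) u^p + 1/y: either u <=
    1/y, or y u > 1 and u <= u (y u)^(p-1). *)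
Lemma powR_sub_le p k a b y : 1 <= p -> p <= k%:R -> 0 < y -> 0 <= b -> b <= a ->
  a `^ p - b `^ p <= k%:R * (y `^ (p - 1) * (a - b) `^ p + a `^ p / y).
Proof.
move=> p1 pk y0 b0 ba.
have [a0|a0] := leP a 0.
  have -> : a = 0 by lra.
  have -> : b = 0 by lra.
  by rewrite subrr mulr_ge0// addr_ge0 ?mulr_ge0 ?invr_ge0 ?powR_ge0// ltW.
pose t := b / a; have bE : b = a * t by rewrite /t mulrC divfK// gt_eqF.
have t0 : 0 <= t by rewrite divr_ge0// ltW.
have t1 : t <= 1 by rewrite ler_pdivrMr// mul1r.
have -> : a - b = a * (1 - t) by rewrite bE mulrBr mulr1.
rewrite {1}bE (powRM _ (ltW a0) t0) (powRM _ (ltW a0)) ?subr_ge0//.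
have tk : 1 - t `^ p <= k%:R * (1 - t).
  apply: le_trans (bernoulli_expr t k _); last by rewrite t0.
  rewrite lerD2l lerN2 -powR_mulrn//.
  have [t00|tn0] := eqVneq t 0; last by rewrite ger_powR// t1 andbT lt_neqAle eq_sym tn0.
  by rewrite t00 !powR0// gt_eqF//; lra.
pose u := 1 - t; have u0 : 0 <= u by rewrite subr_ge0.
have uy : u <= y `^ (p - 1) * u `^ p + y^-1.
  have [uy|uy] := leP u y^-1.
    by apply: (le_trans uy); rewrite lerDr mulr_ge0 ?powR_ge0.
  rewrite -(mulr_powRB1 u0); last lra.
  apply: (@le_trans _ _ (u * (y * u) `^ (p - 1))); last first.
    by rewrite powRM// ?(ltW y0)// mulrCA lerDl invr_ge0 ltW.
  have yu1 : 1 <= y * u by rewrite mulrC -ler_pdivrMr// mul1r ltW.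
  by rewrite ler_peMr// -{1}(powRr0 (y * u)) ler_powR// subr_ge0.
rewrite -/u.
have ap : 0 <= a `^ p by exact: powR_ge0.
apply: (@le_trans _ _ (a `^ p * (k%:R * u))).
  by have := ler_wpM2l ap tk; rewrite mulrBr mulr1.
rewrite mulrCA ler_wpM2l// mulrCA -mulrDr ler_wpM2l//.
Qed.

Lemma powR_dist_le p k a b y : 1 <= p -> p <= k%:R -> 0 < y -> 0 <= a -> 0 <= b ->
  `|a `^ p - b `^ p| <= k%:R * (y `^ (p - 1) * `|a - b| `^ p + (a `^ p + b `^ p) / y).
Proof.
move=> p1 pk y0 a0 b0; wlog ba : a b a0 b0 / b <= a.
  move=> W; have [ba|/ltW ab] := leP b a; first exact: W.
  by rewrite distrC (distrC a) (addrC (a `^ p)); exact: W.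
rewrite !ger0_norm ?subr_ge0//; last by rewrite ge0_ler_powR // ?nnegrE //; lra.
apply: (le_trans (powR_sub_le _ k _ _ _ p1 pk y0 b0 ba)).
rewrite ler_wpM2l// lerD2l mulrDl lerDl divr_ge0 ?powR_ge0// ltW//.
Qed.

End PowerDifference.

Section Coarea.
Context {G : groupType}.
Implicit Types (A X : {fset G}) (u : G).

Definition escapes u A : nat := #|` [fset g in A | (g * u)%g \notin A]%fset|.

(** Peel off the layers of f: if m is the least nonzero value of f and S its support, then f = f' +
    m 1_S, where f' is nonnegative with smaller support. Both sides are additive along this
    decomposition, and the hypothesis at S settles the layer. *)
Lemma coarea {R : realType} (w : seq G) (e : R) X :
  (forall A, (A `<=` X)%fset -> A != fset0 ->
     e * #|` A|%:R <= (\sum_(u <- w) escapes u A)%:R) ->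
  forall f : G -> R, (forall g, 0 <= f g) -> supported f X ->
  e * \sum_(g <- X) f g <=
  \sum_(u <- w) \sum_(g <- X) Num.max (f g - f (g * u)%g) 0.
Proof.
move=> He f; pose S (f : G -> R) := [fset g in X | f g != 0]%fset.
have [n] := ubnP #|` S f|; elim: n f => // n IH f Sn f0 fX.
have SX : (S f `<=` X)%fset by apply/fsubsetP => g; rewrite !inE => /andP[].
have SP g : (g \in S f) = (f g != 0).
  rewrite !inE; case: (boolP (g \in X)) => //= /fX->.
  by rewrite eqxx.
have [S0|[a0 a0S]] := fset_0Vmem (S f).
  rewrite big1 ?mulr0 ?sumr_ge0// => [u _|g _].
    by rewrite sumr_ge0// => g _; rewrite le_max lexx orbT.
  by apply/eqP; apply: contraT; rewrite -SP S0.
have [[a aS] /= _ amin] := @arg_minP _ _ _ [` a0S]%fset xpredT (fun g => f (val g)) isT.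
have {}amin g : g \in S f -> f a <= f g by move=> gS; exact: (amin [` gS]%fset).
pose m := f a; pose f' g := f g - m * (g \in S f)%:R.
have m0 : 0 < m by rewrite lt_neqAle eq_sym -SP aS f0.
have f'0 g : 0 <= f' g.
  rewrite /f'; case: (boolP (g \in S f)) => gS; last by rewrite mulr0 subr0.
  by rewrite mulr1 subr_ge0 amin.
have f'X : supported f' X.
  by move=> g gX; rewrite /f' SP fX// eqxx mulr0 subr0.
have S'S : (S f' `<` S f)%fset.
  rewrite fproperE; apply/andP; split.
    apply/fsubsetP => g; rewrite !inE /f' SP => /andP[->]; apply: contra => /eqP->.
    by rewrite eqxx mulr0 subr0.
  by apply/negP => /fsubsetP/(_ _ aS); rewrite !inE /f' aS mulr1 subrr eqxx andbF.
have {}IH := IH f' (leq_trans (fproper_ltn_card S'S) Sn) f'0 f'X.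
have SE : [fset g in X | g \in S f]%fset = S f.
  by apply/fsetP => g; rewrite !inE andbA andbb.
have -> : \sum_(g <- X) f g = \sum_(g <- X) f' g + m * #|` S f|%:R.
  rewrite -{1}SE -sumr_fset_card mulr_sumr -big_split/=; apply: eq_bigr => g _.
  by rewrite /f' subrK.
(* The positive part changes only when g is in S and g u is not: then f and f' vanish at g u, and
   f(g) >= m. When only g u is in S, both positive parts are 0, since f(g u) >= m. *)
have -> : \sum_(u <- w) \sum_(g <- X) Num.max (f g - f (g * u)%g) 0 =
    \sum_(u <- w) \sum_(g <- X) Num.max (f' g - f' (g * u)%g) 0
    + m * (\sum_(u <- w) escapes u (S f))%:R.
  rewrite natr_sum mulr_sumr -big_split/=; apply: eq_bigr => u _.
  have -> : escapes u (S f) =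
      #|` [fset g in X | (g \in S f) && ((g * u)%g \notin S f)]%fset|.
    by congr #|` _|; apply/fsetP => g; rewrite !inE !andbA andbb.
  rewrite -sumr_fset_card mulr_sumr -big_split/=; apply: eq_bigr => g _.
  rewrite /f'; have [gS|gS] := boolP (g \in S f); have [guS|guS] := boolP ((g * u)%g \in S f).
  - by rewrite /= !mulr1 mulr0 addr0; congr (Num.max _ _); ring.
  - rewrite /= !mulr1 mulr0 subr0.
    have -> : f (g * u)%g = 0 by apply/eqP; move: guS; rewrite SP negbK.
    have := amin _ gS; rewrite -/m !subr0 => mg.
    by rewrite !max_l ?subrK ?subr_ge0// (le_trans _ mg)// ltW.
  - have -> : f g = 0 by apply/eqP; move: gS; rewrite SP negbK.
    rewrite /= !mulr0 !mulr1 addr0 subr0 !sub0r !max_r// oppr_le0 ?f0// subr_ge0.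
    exact: amin.
  - by rewrite /= !mulr0 addr0 !subr0.
rewrite mulrDr lerD// mulrCA ler_pM2l//; apply: He => //.
by apply/fset0Pn; exists a.
Qed.

(** If every nonempty subset of X had a large boundary, [coarea] for f^p would bound the norm by the
    variation of f^p, which [powR_dist_le] bounds by the energies of f up to an error of order
    1/y. *)
Lemma Folner_superlevel {R : realType} (p e y : R) k (w : seq G) (f : G -> R) X :
  1 <= p -> p <= k%:R -> 0 < y -> (forall g, 0 <= f g) -> supported f X ->
  k%:R * (y `^ (p - 1) * (\sum_(u <- w) energy p u f)
    + 2 * (size w)%:R * (\sum_(g <- X) f g `^ p) / y)
    < e * \sum_(g <- X) f g `^ p ->
  exists A : {fset G}, [/\ (A `<=` X)%fset, A != fset0 &
    (\sum_(u <- w) escapes u A)%:R < e * #|` A|%:R].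
Proof.
move=> p1 pk y0 f0 fX; apply: contraPP => noA.
have p0 : p != 0 by rewrite gt_eqF//; lra.
have fpX : supported (fun g => f g `^ p) X by move=> g /fX ->; rewrite powR0.
apply/negP; rewrite -leNgt.
have /coarea/(_ (fun g => f g `^ p)) : forall A, (A `<=` X)%fset -> A != fset0 ->
    e * #|` A|%:R <= (\sum_(u <- w) escapes u A)%:R.
  by move=> A AX An0; rewrite leNgt; apply/negP => Ae; apply: noA; exists A.
move=> /(_ (fun g => powR_ge0 _ _) fpX) /le_trans; apply.
rewrite [y `^ (p - 1) * _]mulr_sumr.
have -> : 2 * (size w)%:R * (\sum_(g <- X) f g `^ p) / y =
    \sum_(u <- w) (2 * (\sum_(g <- X) f g `^ p) / y).
  by rewrite big_const_seq count_predT iter_addr_0 -[RHS]mulr_natr; ring.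
rewrite -big_split/= mulr_sumr; apply: ler_sum => u _.
pose F g := k%:R * (y `^ (p - 1) * `|f g - f (g * u)%g| `^ p
  + (f g `^ p + f (g * u)%g `^ p) / y).
apply: (@le_trans _ _ (\sum_(g <- X) F g)).
  apply: ler_sum => g _; apply: le_trans (powR_dist_le _ _ _ _ _ p1 pk y0 (f0 _) (f0 _)).
  by rewrite ge_max ler_norm normr_ge0.
rewrite -mulr_sumr ler_wpM2l// big_split/= -mulr_sumr lerD//.
  rewrite ler_wpM2l ?powR_ge0//; apply: (@sum_le_fsbig _ _ _ _ (energy_supp X u)).
    by move=> g; exact: powR_ge0.
  by move=> g; exact: energy_term0.
(* The factor 2 comes from here: the sums over X of f(g)^p and of f(g u)^p are both at most the full
   sum of f^p. *)
rewrite -mulr_suml ler_wpM2r ?invr_ge0 ?(ltW y0)// big_split/= mulr_natl mulr2n lerD2l.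
rewrite -[leRHS](fsbigTE X)// -(fsbig_shift (fun g => f g `^ p) u).
apply: (@sum_le_fsbig _ _ _ _ [fset (g * u^-1)%g | g in X]%fset) => g.
  exact: powR_ge0.
move=> gX; apply: fpX; apply: contra gX => gX.
by apply/imfsetP; exists (g * u)%g; rewrite //= mulgK.
Qed.

End Coarea.

(** * Fibres and dense subsets *)

Section DenseSubset.
Local Open Scope fset_scope.
Context {T : choiceType}.
Implicit Types (A B : {fset T}) (P : rel T).

Definition cls P A a : {fset T} := [fset b in A | P a b]%fset.

Definition saturation P A B : {fset T} :=
  [fset a in A | [exists b : B, P (val b) a]]%fset.

Lemma saturationP P A B a :
  reflect (a \in A /\ exists2 b, b \in B & P b a) (a \in saturation P A B).
Proof.
rewrite !inE; apply: (iffP andP) => -[aA].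
  by move=> /existsP[[b bB] /= ba]; split => //; exists b.
by move=> [b bB ba]; split => //; apply/existsP; exists [` bB]%fset.
Qed.

Lemma saturationS P A B B' :
  (B' `<=` B)%fset -> (saturation P A B' `<=` saturation P A B)%fset.
Proof.
move=> /fsubsetP BB; apply/fsubsetP => a /saturationP[aA [b /BB bB ba]].
by apply/saturationP; split => //; exists b.
Qed.

(** Once B has lost its class of b, its saturation misses the whole class of b in A. *)
Lemma card_saturationD P A B b : symmetric P -> transitive P -> b \in B ->
  (#|` saturation P A (B `\` cls P B b)| + #|` cls P A b|
     <= #|` saturation P A B|)%N.
Proof.
move=> sP tP bB; rewrite -cardfsUI.
have -> : (saturation P A (B `\` cls P B b) `&` cls P A b = fset0)%fset.
  apply/fsetP => a; rewrite in_fsetI [RHS]in_fset0; apply/negP.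
  move=> /andP[/saturationP[aA [c]]]; rewrite in_fsetD !inE.
  move=> /andP[+ cB] ca /andP[_ ba]; rewrite cB /= => /negP; apply.
  by rewrite (tP _ _ _ ba)// sP.
rewrite cardfs0 addn0; apply: fsubset_leq_card.
rewrite fsubUset saturationS ?fsubsetDl//=.
apply/fsubsetP => a; rewrite !inE/= => /andP[aA ba].
by rewrite aA; apply/existsP; exists [` bB]%fset.
Qed.

Lemma card_clsD P B b :
  (#|` B `\` cls P B b| + #|` cls P B b| = #|` B|)%N.
Proof.
rewrite -(cardfsID (cls P B b) B) addnC; congr (#|` _| + _)%N.
by apply/esym/fsetIidPr/fsubsetP => a; rewrite !inE => /andP[].
Qed.

(* Among the nonempty [B] whose size exceeds a quarter of
   [#|saturation P A B| + 2 #|saturation Q A B|], take a minimal one: deleting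
   a whole class would violate the inequality, so no class can be sparse. *)
Lemma dense_subset P Q A A0 :
  reflexive P -> symmetric P -> transitive P ->
  reflexive Q -> symmetric Q -> transitive Q ->
  A0 `<=` A -> (3 * #|` A| < 4 * #|` A0|)%N ->
  exists B, [/\ B `<=` A0, B != fset0 &
    forall b, b \in B -> (#|` cls P A b| < 4 * #|` cls P B b|)%N /\
                         (#|` cls Q A b| < 2 * #|` cls Q B b|)%N].
Proof.
move=> rP sP tP rQ sQ tQ A0A cardA.
pose large B := (#|` saturation P A B| + 2 * #|` saturation Q A B| < 4 * #|` B|)%N.
(* Both saturations lie in A, so the weighted sum is at most 3 #|A|. *)
have lA0 : large A0.
  have sat R : (#|` saturation R A A0| <= #|` A|)%N.
    by apply: fsubset_leq_card; apply/fsubsetP => a /saturationP[].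
  by rewrite /large; have := sat P; have := sat Q; lia.
have [n] := ubnP #|` A0|; elim: n A0 A0A lA0 {cardA} => // n IH B BA lB Bn.
have [Bgood|] := pselect (forall b, b \in B ->
    (#|` cls P A b| < 4 * #|` cls P B b|)%N /\
    (#|` cls Q A b| < 2 * #|` cls Q B b|)%N).
  exists B; split => //; rewrite -cardfs_gt0; move: lB; rewrite /large; lia.
move=> /existsNP[b /not_implyP[bB bbad]].
have remove R : reflexive R -> large (B `\` cls R B b) ->
    exists B', [/\ B' `<=` B, B' != fset0 &
      forall b, b \in B' -> (#|` cls P A b| < 4 * #|` cls P B' b|)%N /\
                            (#|` cls Q A b| < 2 * #|` cls Q B' b|)%N].
  move=> rR lB'; have [|B' [B'B B'0 B'P]] := IH _ (fsubset_trans (fsubsetDl _ _) BA) lB'.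
    have : (0 < #|` cls R B b|)%N.
      by rewrite cardfs_gt0; apply/fset0Pn; exists b; rewrite !inE bB rR.
    by have := card_clsD R B b; lia.
  by exists B'; split => //; rewrite (fsubset_trans B'B)// fsubsetDl.
have satS R S : (#|` saturation R A (B `\` cls S B b)| <= #|` saturation R A B|)%N.
  by rewrite fsubset_leq_card// saturationS// fsubsetDl.
have [Pb|Pb] := ltnP #|` cls P A b| (4 * #|` cls P B b|).
  have [Qb|Qb] := ltnP #|` cls Q A b| (2 * #|` cls Q B b|); first by case: bbad.
  (* The left side of [large] drops by at least 2 #|cls Q A b|, which is at least the loss 4 #|cls Q
     B b| on the right. For P the weight 1 is offset by the threshold 4. *)
  apply: (remove Q rQ); move: lB; rewrite /large.
  have := card_saturationD _ A _ _ sQ tQ bB; have := card_clsD Q B b.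
  by have := satS P Q; lia.
apply: (remove P rP); move: lB; rewrite /large.
have := card_saturationD _ A _ _ sP tP bB; have := card_clsD P B b.
by have := satS Q P; lia.
Qed.

End DenseSubset.

Section BadFibres.
Local Open Scope fset_scope.
Context {R : realType} {G K : groupType} (i : K -> G).
Hypotheses (iM : {morph i : x y / (x * y)%g}) (i_inj : injective i).

Lemma leq_card_bigfcup (I : Type) (r : seq I) (F : I -> {fset G}) :
  (#|` \bigcup_(j <- r) F j| <= \sum_(j <- r) #|` F j|)%N.
Proof.
elim/big_rec2: _ => [|j n B _ IH]; first by rewrite cardfs0.
by rewrite cardfsU; lia.
Qed.

Definition coset_rel : rel G := fun g a => `[< exists k, a = (g * i k)%g >].

Lemma embed1 : i 1%g = 1%g.
Proof. by apply: (mulgI (i 1%g)); rewrite -iM !mulg1. Qed.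

Lemma coset_rel_refl : reflexive coset_rel.
Proof. by move=> g; apply/asboolP; exists 1%g; rewrite embed1 mulg1. Qed.

Lemma coset_rel_sym : symmetric coset_rel.
Proof.
suff sub g a : coset_rel g a -> coset_rel a g by move=> g a; apply/idP/idP => /sub.
move=> /asboolP[k ->]; apply/asboolP; exists k^-1%g.
by rewrite -mulgA -iM mulgV embed1 mulg1.
Qed.

Lemma coset_rel_trans : transitive coset_rel.
Proof.
move=> b a c /asboolP[k ->] /asboolP[l ->]; apply/asboolP.
by exists (k * l)%g; rewrite iM mulgA.
Qed.

(** The part of A in the coset g i(K), transported to K with g as origin, so that it can be tested
    against the Folner condition of K. *)
Definition fibre (A : {fset G}) g : {fset K} :=
  fset_set [set k | (g * i k)%g \in A].

(** Injectivity of [i] makes the preimage of A finite, so [fset_set] keeps its elements. *)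
Lemma in_fibre A g k : (k \in fibre A g) = ((g * i k)%g \in A).
Proof.
rewrite in_fset_set; first by apply/idP/idP; rewrite inE.
apply: (finite_preimage (f := fun k => (g * i k)%g) (B := [set` A])) => //.
by move=> x y _ _ /mulgI/i_inj.
Qed.

Lemma cls_coset A g : cls coset_rel A g = [fset (g * i k)%g | k in fibre A g].
Proof.
apply/fsetP => a; rewrite !inE; apply/andP/imfsetP => [[aA /asboolP[k ak]]|[k /=]].
  by exists k; rewrite //= in_fibre -ak.
by rewrite in_fibre => kA ->; split => //; apply/asboolP; exists k.
Qed.

Lemma card_fibre A g : #|` fibre A g| = #|` cls coset_rel A g|.
Proof. by rewrite cls_coset card_imfset//= => x y /mulgI/i_inj. Qed.

(** A boundary point is an endpoint l s outside the fibre; the right side counts the starting points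
    l for each s. Several pairs may share an endpoint, whence an inequality. *)
Lemma card_boundary_fibre (S : {fset K}) A g :
  (#|` boundary S (fibre A g)| <=
   \sum_(s <- S) #|` [fset a in cls coset_rel A g | (a * i s)%g \notin A]|)%N.
Proof.
have -> : #|` boundary S (fibre A g)| =
    #|` [fset (g * i k)%g | k in boundary S (fibre A g)]|.
  by rewrite [RHS]card_imfset// => x y /mulgI/i_inj.
apply: (@leq_trans #|` \bigcup_(s <- S) [fset (a * i s)%g |
    a in [fset a in cls coset_rel A g | (a * i s)%g \notin A]]|); last first.
  apply: (leq_trans (leq_card_bigfcup _ _ _)); apply: leq_sum => s _.
  exact: leq_imfset_card.
apply: fsubset_leq_card; apply/fsubsetP => a /imfsetP[k /=].
rewrite !inE => /andP[kA /imfset2P[l /= lA [s /= sS kE]]] ->.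
apply/bigfcupP; exists s; rewrite ?sS//; apply/imfsetP; exists (g * i l)%g.
  rewrite /= !inE/= -mulgA -iM -kE.
  rewrite in_fibre in kA; rewrite in_fibre in lA; rewrite lA kA andbT.
  by apply/asboolP; exists l.
by rewrite kE iM mulgA.
Qed.

(** Double counting. A bad fibre with c points has more than c / x boundary points, so charging each
    of its points x / c per exit gives at least 1. After exchanging the sums, each exit is charged
    by the c points of its own fibre, hence x in total. *)
Lemma card_bad_fibres (S : {fset K}) (x : R) A : 0 < x ->
  #|` [fset g in A |
       ~~ (#|` boundary S (fibre A g)|%:R / #|` fibre A g|%:R <= 1 / x :> R)]|%:R
  <= x * (\sum_(s <- S) escapes (i s) A)%:R :> R.
Proof.
move=> x0; rewrite -sumr_fset_card.
pose c g : R := #|` cls coset_rel A g|%:R.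
have c0 g : g \in A -> 0 < c g.
  move=> gA; rewrite ltr0n cardfs_gt0; apply/fset0Pn; exists g.
  by rewrite !inE gA coset_rel_refl.
pose out s a : bool := (a * i s)%g \notin A.
apply: (@le_trans _ _ (\sum_(g <- A) \sum_(s <- S) \sum_(a <- A)
    x / c g * (coset_rel g a && out s a)%:R)).
  rewrite big_seq [leRHS]big_seq; apply: ler_sum => g gA.
  have -> : \sum_(s <- S) \sum_(a <- A) x / c g * (coset_rel g a && out s a)%:R =
      x / c g * (\sum_(s <- S) #|` [fset a in cls coset_rel A g | out s a]|)%:R.
    rewrite natr_sum mulr_sumr; apply: eq_bigr => s _.
    rewrite -mulr_sumr sumr_fset_card; congr (_ * #|` _|%:R).
    by apply/fsetP => a; rewrite !inE/= andbA.
  have xc : 0 < x / c g by rewrite divr_gt0 ?c0.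
  case: (boolP (_ / _ <= 1 / x)) => [_|]; first by apply: mulr_ge0; rewrite // ltW.
  rewrite card_fibre -/(c g) -ltNge ltr_pdivlMr ?c0// => lt_bd.
  apply: (@le_trans _ _ (x / c g * #|` boundary S (fibre A g)|%:R)).
    rewrite -ler_pdivrMl// mulr1 invf_div ltW// (le_lt_trans _ lt_bd)//.
    by rewrite div1r mulrC.
  by rewrite ler_pM2l// ler_nat card_boundary_fibre.
rewrite exchange_big/= natr_sum mulr_sumr; apply: ler_sum => s _.
rewrite exchange_big/= -sumr_fset_card mulr_sumr.
rewrite big_seq [leRHS]big_seq; apply: ler_sum => a aA.
rewrite (eq_bigr (fun g => x * (out s a)%:R / c a * (coset_rel g a)%:R)) => [|g _].
  have -> : \sum_(g <- A) x * (out s a)%:R / c a * (coset_rel g a)%:R =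
      x * (out s a)%:R / c a * c a.
    rewrite -mulr_sumr sumr_fset_card; congr (_ * #|` _|%:R).
    by apply/fsetP => g; rewrite !inE coset_rel_sym.
  by rewrite divfK// gt_eqF// c0.
case: (boolP (coset_rel g a)) => ga; last by rewrite !mulr0.
have -> : c g = c a.
  congr #|` _|%:R; apply/fsetP => b; rewrite !inE; congr (_ && _).
  apply/idP/idP => [|ab]; last exact: coset_rel_trans ga ab.
  by apply: coset_rel_trans; rewrite coset_rel_sym.
by rewrite /= mulr1; ring.
Qed.

End BadFibres.

(** * Halos *)

Section Halo.
Context {H : groupType} (L : halo_product H).
Implicit Types (S T : set H) (x y : lamps L) (g h k s : H).

Local Notation blk S := (subgroup_set (block L S)).

Lemma block1 S : 1%g \in blk S.
Proof. by have [] := subgroupP (block L S). Qed.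

Lemma blockM S x y :
  x \in blk S -> y \in blk S -> (x * y)%g \in blk S.
Proof. exact: (group_closedM (subgroupP (block L S))). Qed.

Lemma blockV S x : x \in blk S -> x^-1%g \in blk S.
Proof. exact: (group_closedV (subgroupP (block L S))). Qed.

Lemma block_sub S T x : S `<=` T -> x \in blk S -> x \in blk T.
Proof.
by move=> ST; rewrite !inE => xS; exact: (halo_mono (block_halo L) ST).
Qed.

Lemma block_disjoint S T x : S `&` T = set0 ->
  x \in blk S -> x \in blk T -> x = 1%g.
Proof.
move=> ST /set_mem xS /set_mem xT.
have := haloI (block_halo L) S T; rewrite ST (halo0 (block_halo L)) => ST1.
suff: [set 1%g] x by [].
by rewrite ST1.
Qed.

Lemma block_act h S x : x \in blk S ->
  lamps_act L h x \in blk [set (h * k)%g | k in S].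
Proof. by move=> /set_mem xS; rewrite inE -lamps_act_block; exists x. Qed.

Section Counting.
Local Open Scope fset_scope.
Variables (s0 : H) (P Q : rel L).
Hypothesis fibreP : forall a b : L, P a b <-> b.1 = a.1.
Hypothesis lineP : forall a b : L, Q a b ->
  b.2 = a.2 /\ (a.1^-1 * b.1)%g \in blk [set a.2; (a.2 * s0)%g].

(* Fix a line through [a] in direction [h = a.2]. Its points lie in distinct
   cosets of [L(H \ {h, h s0})], and along the directions other than
   [h, h s0, h s0^-1] the lines stay inside these cosets. *)
Lemma card_grid q b (B : {fset L}) : (0 < q)%N -> B != fset0 ->
  (forall a, a \in B -> b <= #|` cls P B a|)%N ->
  (forall a, a \in B -> q <= #|` cls Q B a|)%N ->
  (q ^ b <= #|` B| ^ 3)%N.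
Proof.
move=> q0; have [n] := ubnP b; elim: n b B => // n IH b B bn /fset0Pn[a aB] BP BQ.
have clsB (E : rel L) (C : {fset L}) c : cls E C c `<=` C.
  by apply/fsubsetP => d; rewrite !inE => /andP[].
have qB : (q <= #|` B|)%N by rewrite (leq_trans (BQ _ aB))// fsubset_leq_card.
(* Base case: the line through a alone has at least q points. *)
have [b3|b3] := leqP b 3.
  by rewrite (leq_trans (leq_pexp2l q0 b3))// leq_exp2r.
(* [bad] lists the directions k for which {k, k s0} meets {h, h s0}. Dropping them costs each fibre
   at most three points, which is where the exponent 3 comes from. *)
pose h := a.2; pose bad := [:: h; (h * s0)%g; (h * s0^-1)%g].
pose far : set H := ~` [set h; (h * s0)%g].
pose part (c : L) := [fset d in B | ((c.1^-1 * d.1)%g \in blk far) && (d.2 \notin bad)].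
pose l := cls Q B a.
have partB c d : d \in part c -> d \in B by rewrite !inE => /andP[].
have part_fibre c d : d \in B -> (c.1^-1 * d.1)%g \in blk far ->
    (b - 3 <= #|` cls P (part c) d|)%N.
  move=> dB cd.
  pose E := [fset x in [seq (d.1, k) : L | k <- bad]].
  have E3 : (#|` E| <= 3)%N by rewrite card_fseq (leq_trans (size_undup _)).
  apply: (@leq_trans #|` cls P B d `\` E|).
    rewrite cardfsD leq_sub ?BP// (leq_trans _ E3)// fsubset_leq_card//.
    exact: fsubsetIr.
  apply: fsubset_leq_card; apply/fsubsetP => y; rewrite in_fsetD => /andP[yE].
  rewrite !inE => /andP[yB Pdy]; have y1 := (fibreP _ _).1 Pdy.
  rewrite yB Pdy y1 cd !andbT/=; apply: contra yE => ybad.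
  rewrite in_fset (_ : y = (d.1, y.2)); last by rewrite -y1; case: (y).
  by apply: (@map_f _ _ (fun k => (d.1, k) : L)); rewrite !inE.
have part_line c d : d \in part c -> (q <= #|` cls Q (part c) d|)%N.
  rewrite !inE/= => /andP[dB /andP[cd dbad]].
  apply: (leq_trans (BQ _ dB)); apply: fsubset_leq_card; apply/fsubsetP => y.
  rewrite !inE/= => /andP[yB Qdy]; have [y2 dy] := lineP _ _ Qdy.
  rewrite yB Qdy y2 dbad !andbT/=.
  have -> : (c.1^-1 * y.1)%g = ((c.1^-1 * d.1) * (d.1^-1 * y.1))%g.
    by rewrite mulgA mulgK.
  rewrite blockM//; apply: block_sub dy => z /= [] -> [].
  - by move=> /eqP dh; rewrite dh in dbad.
  - by move=> /eqP dh; rewrite dh orbT in dbad.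
  - by move=> dh; move: dbad; rewrite -dh mulgK eqxx !orbT.
  - by move=> /mulIg/eqP dh; rewrite dh in dbad.
(* The integer cube root of q^(b - 3), rounded up: the induction hypothesis says that each part has
   at least r points. *)
have [r qr rmin] : exists2 r, (q ^ (b - 3) <= r ^ 3)%N &
    forall r', (q ^ (b - 3) <= r' ^ 3)%N -> (r <= r')%N.
  have ex : exists r, (q ^ (b - 3) <= r ^ 3)%N.
    by exists (q ^ (b - 3))%N; rewrite -expnM leq_pexp2l ?leq_pmulr.
  by have [r qr rmin] := ex_minnP ex; exists r.
have cardpart c : c \in l -> (r <= #|` part c|)%N.
  rewrite !inE => /andP[cB _]; apply: rmin; apply: IH.
  - by lia.
  - rewrite -cardfs_gt0 (leq_trans _ (fsubset_leq_card (clsB P _ c)))//.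
    apply: leq_trans (part_fibre _ _ cB _); first by lia.
    by rewrite mulVg block1.
  - by move=> d; rewrite !inE/= => /andP[dB /andP[cd _]]; exact: part_fibre.
  - by move=> d /part_line.
(* If d lies in the parts of c and c', then c'^-1 c has its lamps in both L({h, h s0}) and L([far]),
   so c = c'. *)
have disj d : (\sum_(c <- l) (d \in part c) <= 1)%N.
  rewrite sum_fset_card; have [->|[c]] := fset_0Vmem [fset c in l | d \in part c].
    by rewrite cardfs0.
  move=> cl; rewrite -(cardfs1 c); apply: fsubset_leq_card; apply/fsubsetP => c'.
  move: cl; rewrite !inE/= => /andP[/andP[_ ac] /andP[_ /andP[cd _]]].
  move=> /andP[/andP[_ ac'] /andP[_ /andP[c'd _]]].
  have [c2 lc] := lineP _ _ ac; have [c'2 lc'] := lineP _ _ ac'.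
  suff e1 : (c'.1^-1 * c.1)%g = 1%g.
    rewrite [c]surjective_pairing [c']surjective_pairing c2 c'2.
    by rewrite -[c.1](mulVKg c'.1) e1 mulg1.
  apply: (@block_disjoint [set h; (h * s0)%g] far); first exact: setICr.
    have -> : (c'.1^-1 * c.1)%g = ((a.1^-1 * c'.1)^-1 * (a.1^-1 * c.1))%g.
      by rewrite invgM invgK mulgA mulgK.
    by rewrite blockM// blockV.
  have -> : (c'.1^-1 * c.1)%g = ((c'.1^-1 * d.1) * (c.1^-1 * d.1)^-1)%g.
    by rewrite invgM invgK mulgA mulgK.
  by rewrite blockM// blockV.
have qrB : (q * r <= #|` B|)%N.
  apply: (@leq_trans (\sum_(c <- l) #|` part c|)%N).
    apply: (@leq_trans (#|` l| * r)%N); first by rewrite leq_mul2r BQ ?orbT.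
    rewrite card_fset_sum1 big_distrl/= big_seq [leqRHS]big_seq.
    by apply: leq_sum => c cl; rewrite mul1n cardpart.
  rewrite (eq_bigr (fun c => (\sum_(d <- B) (d \in part c))%N)) => [|c _].
    rewrite exchange_big/= card_fset_sum1; exact: leq_sum.
  rewrite sum_fset_card; congr #|` _|; apply/fsetP => d.
  by rewrite !inE; case: (_ \in _).
(* The q disjoint parts give q r points, and the cube of the factor q makes up for the three dropped
   points of each fibre. *)
apply: (@leq_trans ((q * r) ^ 3)); last by rewrite leq_exp2r.
by rewrite -(subnK (ltnW b3)) expnD expnMn mulnC leq_mul2l qr orbT.
Qed.

End Counting.
End Halo.

(** * Lower bound *)

(** By well-ordering, an infimum of cardinalities is attained unless it is taken over the empty
    set. *)
Lemma ereal_inf_natP (R : realType) (T : Type) (P : set T) (c : T -> nat) :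
  (P = set0 /\ ereal_inf [set (c a)%:R%:E | a in P] = +oo%E :> \bar R) \/
  exists a, [/\ P a, ereal_inf [set (c a)%:R%:E | a in P] = (c a)%:R%:E :> \bar R &
    forall b, P b -> (c a <= c b)%N].
Proof.
have [->|/set0P[a0 Pa0]] := eqVneq P set0.
  by left; rewrite image_set0 ereal_inf0.
right; have ex : exists n, `[< exists2 a, P a & c a = n >].
  by exists (c a0); apply/asboolP; exists a0.
have [n /asboolP[a Pa ca] nmin] := ex_minnP ex.
have amin b : P b -> (c a <= c b)%N.
  by move=> Pb; rewrite ca; apply: nmin; apply/asboolP; exists b.
exists a; split => //; apply/le_anti/andP; split.
  by apply: ereal_inf_lbound; exists a.
by apply: le_ereal_inf_tmp => _ [b Pb <-]; rewrite lee_fin ler_nat amin.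
Qed.

Section FolnerFunctions.
Context {R : realType} {G : groupType}.
Implicit Types (p x : R) (f : G -> R) (S X : {fset G}).

Lemma energy_generated_seq p (B : set G) (w : seq G) : 0 < p ->
  (forall u, u \in w -> generated B u) ->
  exists w' : seq G, exists2 K : R, 0 <= K & (forall v, v \in w' -> B v) /\
    forall f X, supported f X ->
      \sum_(u <- w) energy p u f <= K * \sum_(v <- w') energy p v f.
Proof.
move=> p0; elim: w => [|u w IH] wB.
  by exists [::], 0 => //; split => // f X _; rewrite !big_nil mulr0.
have [|w1 [K1 K10 [B1 E1]]] := IH; first by move=> v vw; apply: wB; rewrite inE vw orbT.
have [|w2 [K2 K20 [B2 E2]]] := energy_generated p B u p0; first by apply: wB; rewrite mem_head.
exists (w1 ++ w2), (K1 + K2); first exact: addr_ge0.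
split=> [t|f X fX]; first by rewrite mem_cat => /orP[/B1|/B2].
rewrite big_cons big_cat/=; have := E1 _ _ fX; have := E2 _ _ fX.
have : 0 <= \sum_(v <- w1) energy p v f by rewrite sumr_ge0// => *; exact: energy_ge0.
have : 0 <= \sum_(v <- w2) energy p v f by rewrite sumr_ge0// => *; exact: energy_ge0.
nra.
Qed.

Lemma lp_grad_energy p S f X : p != 0 -> supported f X ->
  lp_grad S p f = (\sum_(s <- S) energy p s f) `^ p^-1.
Proof.
move=> p0 fX; congr (_ `^ _).
pose Y := (\bigcup_(s <- S) energy_supp X s)%fset.
have YS s : s \in S -> (energy_supp X s `<=` Y)%fset.
  by move=> sS; apply: (bigfcup_sup (P := xpredT)).
rewrite (fsbigTE Y) => [|g gY].
  rewrite exchange_big/= big_seq [RHS]big_seq; apply: eq_bigr => s sS.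
  by rewrite (energyE _ _ _ X Y)// YS.
rewrite big_seq big1// => s sS; apply: (energy_term0 _ _ _ X) => //.
by apply: contra gY; apply: (fsubsetP (YS _ sS)).
Qed.

Lemma powR_ratio_le p x (E N : R) : 0 < p -> 0 < x -> 0 <= E -> 0 < N ->
  (E `^ p^-1 / N `^ p^-1 <= 1 / x) = (x `^ p * E <= N).
Proof.
move=> p0 x0 E0 N0.
have inv y : 0 <= y -> (y `^ p^-1) `^ p = y.
  by move=> y0; rewrite -powRrM mulVf ?gt_eqF// powRr1.
rewrite ler_pdivrMr ?powR_gt0// mulrC mulrA mulr1 ler_pdivlMr// mulrC.
rewrite -[in RHS](inv E)// -powRM ?powR_ge0//; last exact: ltW.
rewrite -[in RHS](inv N) ?(ltW N0)//; apply/idP/idP.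
  by move=> le; rewrite ge0_ler_powR ?nnegrE ?mulr_ge0 ?powR_ge0 ?(ltW p0) ?(ltW x0).
apply: contraTT; rewrite -!ltNge => lt.
by rewrite gt0_ltr_powR ?nnegrE ?mulr_ge0 ?powR_ge0 ?(ltW x0).
Qed.

(** Raising to the power p makes the condition linear in the energies, the form in which different
    generating sets can be compared. *)
Lemma Folnerp_ratio p x S f X : 0 < p -> 0 < x ->
  (forall g, 0 <= f g) -> supported f X -> (exists g, f g != 0) ->
  (lp_grad S p f / lp_norm p f <= 1 / x) =
  (x `^ p * \sum_(s <- S) energy p s f <= \sum_(g <- X) f g `^ p).
Proof.
move=> p0 x0 f0 fX [g fg].
have pn0 : p != 0 by rewrite gt_eqF.
have gX : g \in X by apply: contraNT fg => /fX->.
rewrite (lp_grad_energy _ _ _ X)// /lp_norm (fsbigTE X) => [|h /fX->]; last first.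
  by rewrite normr0 powR0.
under eq_bigr do rewrite ger0_norm//.
rewrite powR_ratio_le// ?sumr_ge0// => [s _|]; first exact: energy_ge0.
rewrite (big_fsetD1 g)//= ltr_wpDr ?sumr_ge0// => [h _|]; first exact: powR_ge0.
by rewrite powR_gt0// lt_neqAle eq_sym fg f0.
Qed.

End FolnerFunctions.

Section LowerBound.
Context {R : realType} {H : groupType} (L : halo_product H).

Definition emb_base (k : H) : L := (1%g, k).

Definition emb_lamp (s0 : H) (t : subgroup_group (block L [set 1%g; s0])) : L :=
  (val t, 1%g).

Lemma emb_baseM : {morph emb_base : k l / (k * l)%g}.
Proof. by move=> k l; congr pair; rewrite /= aut_act_one mulg1. Qed.

Lemma emb_base_inj : injective emb_base.
Proof. by move=> k l []. Qed.

Lemma emb_lampM s0 : {morph @emb_lamp s0 : t u / (t * u)%g}.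
Proof. by move=> t u; congr pair; rewrite /= ?aut_act1 ?mulg1. Qed.

Lemma emb_lamp_inj s0 : injective (@emb_lamp s0).
Proof. by move=> t u [] /val_inj. Qed.

Lemma coset_baseP (a b : L) : coset_rel emb_base a b <-> b.1 = a.1.
Proof.
split=> [/asboolP[k ->]|ab]; first by rewrite /= aut_act_one mulg1.
apply/asboolP; exists (a.2^-1 * b.2)%g; rewrite [b]surjective_pairing ab.
by congr pair; rewrite /= ?aut_act_one ?mulg1// mulVKg.
Qed.

(** Right multiplication by a lamp t of L({1, s0}) at position h multiplies the lamps by the image
    of t under h, which lies in L({h, h s0}). *)
Lemma coset_lampP s0 (a b : L) : coset_rel (@emb_lamp s0) a b ->
  b.2 = a.2 /\ (a.1^-1 * b.1)%g \in subgroup_set (block L [set a.2; (a.2 * s0)%g]).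
Proof.
move=> /asboolP[t ->]; rewrite /= mulg1 mulKg; split => //.
have := block_act L a.2 _ _ (valP t); congr (_ \in subgroup_set (block L _)).
by rewrite image_setU !image_set1 mulg1.
Qed.

Lemma Folner_grid (SH : {fset H}) s0 (T : {fset subgroup_group (block L [set 1%g; s0])})
    (x : R) (m n : nat) (A : {fset L}) : 0 < x ->
  (forall F : {fset H}, F != fset0 ->
     (#|` boundary SH F|)%:R / (#|` F|)%:R <= 1 / x :> R -> (n <= #|` F|)%N) ->
  (forall F : {fset subgroup_group (block L [set 1%g; s0])}, F != fset0 ->
     (#|` boundary T F|)%:R / (#|` F|)%:R <= 1 / x :> R -> (m <= #|` F|)%N) ->
  A != fset0 ->
  x * (\sum_(s <- SH) escapes (emb_base s) A +
       \sum_(t <- T) escapes (emb_lamp s0 t) A)%:R < #|` A|%:R / 4 :> R ->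
  (m ^ n <= #|` A| ^ 24)%N.
Proof.
move=> x0 Hn Hm A0 escA.
pose P := coset_rel emb_base; pose Q := coset_rel (@emb_lamp s0).
pose bad (K : groupType) (i : K -> L) (S : {fset K}) := [fset g in A |
  ~~ (#|` boundary S (fibre i A g)|%:R / #|` fibre i A g|%:R <= 1 / x :> R)]%fset.
pose A1 := (A `\` (bad _ emb_base SH `|` bad _ (@emb_lamp s0) T))%fset.
(* The two bad sets together have fewer than a quarter of the points of A, as [dense_subset]
   requires. *)
have cardA1 : (3 * #|` A| < 4 * #|` A1|)%N.
  have b1 := card_bad_fibres _ emb_baseM emb_base_inj SH x A x0.
  have b2 := card_bad_fibres _ (emb_lampM s0) (emb_lamp_inj s0) T x A x0.
  have : (#|` bad _ emb_base SH| + #|` bad _ (@emb_lamp s0) T|)%:R < #|` A|%:R / 4 :> R.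
    by apply: le_lt_trans escA; rewrite !natrD mulrDr lerD.
  rewrite ltr_pdivlMr// -natrM ltr_nat => bA.
  have : (#|` A| <= #|` A1| + (#|` bad _ emb_base SH| + #|` bad _ (@emb_lamp s0) T|))%N.
    rewrite -(cardfsID (bad _ emb_base SH `|` bad _ (@emb_lamp s0) T)%fset A) addnC.
    rewrite leq_add2l (leq_trans (fsubset_leq_card (fsubsetIr _ _)))//.
    by rewrite cardfsU leq_subr.
  by lia.
have A1A : (A1 `<=` A)%fset by exact: fsubsetDl.
have good (K : groupType) (i : K -> L) (S : {fset K}) g : {morph i : k l / (k * l)%g} ->
    injective i -> g \in A -> g \notin bad K i S ->
    fibre i A g != fset0 /\
    #|` boundary S (fibre i A g)|%:R / #|` fibre i A g|%:R <= 1 / x :> R.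
  move=> iM iI gA; rewrite !inE gA /= negbK => gS; split => //.
  by apply/fset0Pn; exists 1%g; rewrite in_fibre// (embed1 i iM) mulg1.
have [B [BA1 B0 BP]] := dense_subset P Q A A1
  (coset_rel_refl _ emb_baseM) (coset_rel_sym _ emb_baseM) (coset_rel_trans _ emb_baseM)
  (coset_rel_refl _ (emb_lampM s0)) (coset_rel_sym _ (emb_lampM s0))
  (coset_rel_trans _ (emb_lampM s0)) A1A cardA1.
have BA : (#|` B| <= #|` A|)%N.
  by apply: fsubset_leq_card; apply: fsubset_trans BA1 A1A.
have inA1 g : g \in B -> [/\ g \in A, g \notin bad _ emb_base SH &
    g \notin bad _ (@emb_lamp s0) T].
  move=> /(fsubsetP BA1); rewrite in_fsetD in_fsetU negb_or.
  by move=> /andP[/andP[]].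
(* The density inequalities are strict: fibres of B have more than n / 4 points and lines more than
   m / 2, whence the successors after rounding down. *)
have grid : ((m./2.+1) ^ (n %/ 4).+1 <= #|` B| ^ 3)%N.
  apply: (card_grid L s0 P Q coset_baseP (@coset_lampP s0)) => // g gB.
    have [gA gS _] := inA1 _ gB; have [gP _] := BP _ gB.
    have [F0 /(Hn _ F0)] := good _ _ _ _ emb_baseM emb_base_inj gA gS.
    rewrite (card_fibre _ emb_base_inj) -/P; move: gP; clear; lia.
  have [gA _ gT] := inA1 _ gB; have [_ gQ] := BP _ gB.
  have [F0 /(Hm _ F0)] := good _ _ _ _ (emb_lampM s0) (@emb_lamp_inj s0) gA gT.
  rewrite (card_fibre _ (@emb_lamp_inj s0)) -/Q; move: gQ; clear; lia.
apply: (@leq_trans (#|` B| ^ 24)); last by rewrite leq_exp2r.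
(* The factor 3 comes from [card_grid]. The factor 8 absorbs the densities, as 8 (n %/ 4 + 1) >= 2 n
   and (m./2 + 1)^2 >= m. *)
rewrite -[24%N]/(3 * 8)%N expnM.
apply: (@leq_trans (((m./2.+1) ^ (n %/ 4).+1) ^ 8)); last by rewrite leq_exp2r.
rewrite -expnM; apply: (@leq_trans ((m./2.+1 ^ 2) ^ n)).
  have [->//|n0] := posnP n; rewrite leq_exp2r//.
  by clear; nia.
by rewrite -expnM leq_pexp2l//; clear; lia.
Qed.

(** It suffices to bound from below the support of each f admissible at [C * x]. [Folner_superlevel]
    finds in it a set A to which [Folner_grid] applies, with n and m the two Folner values at x; the
    exponent 1/24 is the root taken of #|A|^24. *)
Lemma Folner_power_le (p : R) (SH : {fset H}) (SL : {fset L}) s0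
    (T : {fset subgroup_group (block L [set 1%g; s0])}) :
  1 <= p -> amenable R H -> generates SL ->
  asymp_le (fun x : R => (Folner T x `^ (24^-1 * fine (Folner SH x))%R)%E)
           (Folnerp p SL).
Proof.
move=> p1 amH genSL; have p0 : 0 < p by lra.
have pn0 : p != 0 by rewrite gt_eqF.
pose w := [seq emb_base s | s <- SH] ++ [seq emb_lamp s0 t | t <- T].
have [|w' [K K0 [w'SL wE]]] := energy_generated_seq p [set` SL] w p0.
  by move=> u _; rewrite genSL.
pose K' := K * (size w')%:R.
(* The word w' may repeat generators, so each of its energies is bounded by the whole sum over [SL];
   hence the factor [size w']. *)
have wSL (f : L -> R) X : supported f X ->
    \sum_(u <- w) energy p u f <= K' * \sum_(s <- SL) energy p s f.
  move=> fX; apply: (le_trans (wE _ _ fX)); rewrite -mulrA ler_wpM2l//.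
  rewrite -[(size w')%:R]mulr1 -mulrA mul1r mulr_natl -iter_addr_0 -count_predT -big_const_seq.
  rewrite big_seq [leRHS]big_seq; apply: ler_sum => v /w'SL /= vSL.
  rewrite (big_fsetD1 v)//= lerDl sumr_ge0// => s _; exact: energy_ge0.
pose k := (Num.truncn p).+1.
have pk : p <= k%:R by rewrite ltW// truncnS_gt.
(* With y = C x and y^p E <= N, where E is the total energy of f over [SL], the left side in
   [Folner_superlevel] is at most k (K' + 2 #w) N / y. It has to be less than N / (4 x), the level 1
   / (4 x) being what [Folner_grid] asks for. *)
pose C := 4 * k%:R * (K' + 2 * (size w)%:R) + 1.
have K'0 : 0 <= K' by rewrite mulr_ge0.
have C0 : 0 < C by rewrite ltr_wpDl// !mulr_ge0// addr_ge0// mulr_ge0.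
exists C => //; exists 1 => //; exists 0; split => // x x0.
rewrite mul1e; apply: le_ereal_inf_tmp => _ [f [f0 f_neq0 fC] <-].
have fX : supported f (finsupp f) by move=> g; exact: fsfun_dflt.
have y0 : 0 < C * x by rewrite mulr_gt0.
have ex : exists g, f g != 0.
  by have /fset0Pn[g] := f_neq0; rewrite mem_finsupp => gf; exists g.
rewrite (Folnerp_ratio _ _ _ _ _ p0 y0 f0 fX ex) in fC.
set N := \sum_(g <- _) _ in fC.
have N0 : 0 < N.
  have [g gf] := ex; rewrite /N (big_fsetD1 g) ?mem_finsupp//=.
  rewrite ltr_wpDr ?sumr_ge0// => [h _|]; first exact: powR_ge0.
  by rewrite powR_gt0// lt_neqAle eq_sym gf f0.
have [|A [AX A0 escA]] :=
    Folner_superlevel p (4 * x)^-1 (C * x) k w f (finsupp f) p1 pk y0 f0 fX.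
  rewrite -/N; set y := C * x in fC y0 *.
  apply: (@le_lt_trans _ _ (k%:R * (K' + 2 * (size w)%:R) * N / y)).
    rewrite -!mulrA ler_wpM2l// (mulrDl K') !mulrA lerD2r.
    rewrite ler_pdivlMr//.
    apply: (@le_trans _ _ (K' * (y `^ p * \sum_(s <- SL) energy p s f))).
      rewrite -(mulr_powRB1 (ltW y0) p0).
      have := wSL _ _ fX; set E1 := \sum_(u <- w) _; set E2 := \sum_(s <- SL) _ => E12.
      have -> : y `^ (p - 1) * E1 * y = y * y `^ (p - 1) * E1 by ring.
      have -> : K' * (y * y `^ (p - 1) * E2) = y * y `^ (p - 1) * (K' * E2) by ring.
      by rewrite ler_wpM2l// mulr_ge0 ?powR_ge0// ltW.
    by rewrite ler_wpM2l.
  rewrite ltr_pdivrMr// /y invfM.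
  have -> : 4^-1 * x^-1 * N * (C * x) = N * C / 4 by field; rewrite gt_eqF.
  by rewrite /C; nra.
have cardA : #|` A|%:R <= #|` finsupp f|%:R :> R.
  by rewrite ler_nat fsubset_leq_card.
have {}escA : x * (\sum_(s <- SH) escapes (emb_base s) A +
    \sum_(t <- T) escapes (emb_lamp s0 t) A)%:R < #|` A|%:R / 4 :> R.
  move: escA; rewrite big_cat/= !big_map -(ltr_pM2l x0).
  by move=> /lt_le_trans; apply; rewrite invfM mulrA mulrCA mulfV ?gt_eqF// mulr1 mulrC.
have grid m n Hn Hm := Folner_grid SH s0 T x m n A x0 Hn Hm A0 escA.
(* Amenability makes [Folner SH x] finite, so [fine] does not alter it. *)
have [[noF _]|[F [[F0 _] FE Fmin]]] := ereal_inf_natP R _ [set F : {fset H} |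
    F != fset0 /\ #|` boundary SH F|%:R / #|` F|%:R <= 1 / x :> R] (fun F => #|` F|).
  have [|F [F0 Fx]] := amH SH (1 / x); first by rewrite divr_gt0.
  have : [set F : {fset H} | F != fset0 /\
      #|` boundary SH F|%:R / #|` F|%:R <= 1 / x :> R] F.
    by split => //; rewrite ler_pdivrMr// ltr0n cardfs_gt0.
  by rewrite noF.
rewrite [Folner SH x]FE /=.
have {}grid m Hm := grid m #|` F| (fun F' F'0 F'x => Fmin F' (conj F'0 F'x)) Hm.
have F1 : (0 < #|` F|)%N by rewrite cardfs_gt0.
have [[noE _]|[E [[E0 Ex] EE Emin]]] := ereal_inf_natP R _
    [set E : {fset subgroup_group (block L [set 1%g; s0])} |
      E != fset0 /\ #|` boundary T E|%:R / #|` E|%:R <= 1 / x :> R] (fun E => #|` E|).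
  (* If no set were admissible in the lamp group, m could be arbitrary in [grid]; this value of m
     contradicts it. *)
  have : ((#|` A| ^ 24).+1 ^ #|` F| <= #|` A| ^ 24)%N.
    apply: grid => E E0 Ex; have : [set E : {fset subgroup_group (block L [set 1%g; s0])} |
      E != fset0 /\ #|` boundary T E|%:R / #|` E|%:R <= 1 / x :> R] E by [].
    by rewrite noE.
  by rewrite leqNgt => /negP[]; have := leq_pexp2l (ltn0Sn (#|` A| ^ 24)) F1; rewrite expn1.
rewrite [Folner T x]EE poweR_EFin lee_fin (le_trans _ cardA)//.
have := grid #|` E| (fun F' F'0 F'x => Emin F' (conj F'0 F'x)).
rewrite mulrC powRrM powR_mulrn// => EFA.
have -> : #|` A|%:R = (#|` A|%:R ^+ 24) `^ 24^-1 :> R.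
  by rewrite -powR_mulrn// -powRrM mulfV ?pnatr_eq0// powRr1.
by rewrite ge0_ler_powR// ?nnegrE// -!natrX ler_nat.
Qed.

End LowerBound.

(** * Upper bound *)

Lemma big_fsetM (V : Type) (idx : V) (op : Monoid.com_law idx) (I J : choiceType)
    (A : {fset I}) (B : {fset J}) (F : I * J -> V) :
  \big[op/idx]_(u <- (A `*` B)%fset) F u =
  \big[op/idx]_(i <- A) \big[op/idx]_(j <- B) F (i, j).
Proof. by rewrite big_imfset2// => -[? ?] [? ?] _ _ /= [-> ->]. Qed.

Lemma cardfsM (I J : choiceType) (A : {fset I}) (B : {fset J}) :
  #|` (A `*` B)%fset| = (#|` A| * #|` B|)%N.
Proof.
rewrite !card_fset_sum1 big_fsetM big_distrl/=.
by apply: eq_bigr => i _; rewrite mul1n.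
Qed.

(** Sum over i first: for each j in Z, at most c values of i contribute, each at most [Psi j]. *)
Lemma fsbig_slices_le (R : realType) (I J : choiceType) (Phi : I * J -> R)
    (Psi : J -> R) (Z : {fset J}) (A : J -> {fset I}) (c : nat) :
  (forall j, 0 <= Psi j) -> (forall u, 0 <= Phi u <= Psi u.2) ->
  (forall u, Phi u != 0 -> (u.2 \in Z) && (u.1 \in A u.2)) ->
  (forall j, #|` A j| <= c)%N ->
  \sum_(u \in [set: I * J]) Phi u <= c%:R * \sum_(j <- Z) Psi j.
Proof.
move=> Psi0 PhiPsi Phi0 Ac.
pose U := (\bigcup_(j <- Z) A j)%fset.
rewrite (fsbigTE (U `*` Z)%fset) => [|u uUZ]; last first.
  apply/eqP; apply: contraNT uUZ => /Phi0 /andP[uZ uA]; rewrite in_fsetM uZ andbT.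
  have AU : (A u.2 `<=` U)%fset by exact: (bigfcup_sup (P := xpredT)).
  exact: (fsubsetP AU).
rewrite big_fsetM exchange_big/= mulr_sumr; apply: ler_sum => j _.
apply: (@le_trans _ _ (\sum_(i <- U) Psi j * (i \in A j)%:R)).
  apply: ler_sum => i _; case: (boolP (i \in A j)) => iA.
    by rewrite mulr1; have /andP[] := PhiPsi (i, j).
  rewrite mulr0 le_eqVlt; apply/orP; left; apply: contraNT iA.
  by move=> /Phi0/andP[].
rewrite -mulr_sumr sumr_fset_card mulrC ler_wpM2r// ler_nat.
apply: leq_trans (Ac j); apply: fsubset_leq_card.
by apply/fsubsetP => i; rewrite !inE => /andP[].
Qed.

Section UpperBound.
Context {R : realType} {H : groupType} (L : halo_product H).
Variables (p : R) (f : H -> R) (F : {fset H}).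
Hypotheses (p0 : 0 < p) (f0 : forall h, 0 <= f h) (fF : supported f F).
Hypothesis blocks : finite_blocks L.

Definition lamp_block : {fset lamps L} := fset_set (block L [set` F]).

Definition lamp_lift (g : L) : R := if g.1 \in lamp_block then f g.2 else 0.

Lemma lamp_blockE x : (x \in lamp_block) = (x \in subgroup_set (block L [set` F])).
Proof. by rewrite in_fset_set//; apply: blocks. Qed.

Lemma lamp_lift_ge0 g : 0 <= lamp_lift g.
Proof. by rewrite /lamp_lift; case: ifP. Qed.

Lemma lamp_lift_le g : lamp_lift g <= f g.2.
Proof. by rewrite /lamp_lift; case: ifP. Qed.

Lemma lamp_lift_supp : supported lamp_lift (lamp_block `*` F : {fset L})%fset.
Proof.
move=> g; rewrite in_fsetM negb_and /lamp_lift; case: ifP => //= _.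
exact: fF.
Qed.

Lemma lamp_lift_norm :
  \sum_(g <- (lamp_block `*` F : {fset L})%fset) lamp_lift g `^ p =
  #|` lamp_block|%:R * \sum_(h <- F) f h `^ p.
Proof.
rewrite big_fsetM card_fset_sum1 natr_sum mulr_suml big_seq [RHS]big_seq.
apply: eq_bigr => x xF; rewrite mul1r; apply: eq_bigr => h _.
by rewrite /lamp_lift /= xF.
Qed.

Lemma energy_lamp_lift_base s :
  energy p ((1%g, s) : L) lamp_lift <= #|` lamp_block|%:R * energy p s f.
Proof.
rewrite (energyE p s f F (energy_supp F s))// ?gt_eqF//.
apply: (fsbig_slices_le _ _ _ _ _ _ (fun=> lamp_block)) => [h|u|u|//].
- exact: powR_ge0.
- rewrite powR_ge0 /lamp_lift /= aut_act_one mulg1; case: ifP => // _.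
  by rewrite subrr normr0 powR0 ?powR_ge0// gt_eqF.
- rewrite /lamp_lift /= aut_act_one mulg1; case: ifP => _; last first.
    by rewrite subrr normr0 powR0 ?eqxx// gt_eqF.
  rewrite andbT; apply: contraNT => uF.
  by rewrite (energy_term0 _ _ _ F)// gt_eqF.
Qed.

(** At position h the move multiplies the lamps by an element of L({h, h s}), which preserves
    membership in L(F) when h and h s are in F. Otherwise either f(h) = 0, or only h is in F and the
    difference is at most f(h) = |f(h) - f(h s)|. *)
Lemma energy_lamp_lift_lamp s x : x \in subgroup_set (block L [set 1%g; s]) ->
  energy p ((x, 1%g) : L) lamp_lift <= (2 * #|` lamp_block|)%:R * energy p s f.
Proof.
move=> xs; have pn0 : p != 0 by rewrite gt_eqF.
rewrite (energyE p s f F (energy_supp F s))//.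
(* The lamps contributing at h lie in L(F) before or after the move, whence the factor 2. *)
pose A h := (lamp_block `|`
  [fset (y * (lamps_act L h x)^-1)%g | y in lamp_block])%fset.
have term0 (u : L) : (u.2 \in F -> (u.2 * s)%g \in F) ->
    `|lamp_lift u - lamp_lift (u * ((x, 1%g) : L))%g| `^ p = 0.
  move=> Fs; rewrite /lamp_lift /= mulg1.
  have [uF|uF] := boolP (u.2 \in F); last by rewrite fF// !if_same subrr normr0 powR0.
  have ux : lamps_act L u.2 x \in subgroup_set (block L [set` F]).
    apply: block_sub (block_act L u.2 _ _ xs) => _ [k [|] /= -> <-].
      by rewrite /= mulg1.
    exact: Fs.
  suff -> : ((u.1 * lamps_act L u.2 x)%g \in lamp_block) = (u.1 \in lamp_block).
    by rewrite subrr normr0 powR0.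
  rewrite !lamp_blockE; apply/idP/idP => [uxF|uF1]; last exact: blockM.
  by rewrite -(mulgK (lamps_act L u.2 x) u.1) blockM// blockV.
apply: (fsbig_slices_le _ _ _ _ _ _ A) => [h|u|u|h].
- exact: powR_ge0.
- rewrite powR_ge0/=; have [us|/not_implyP[uF /negP usF]] :=
      pselect (u.2 \in F -> (u.2 * s)%g \in F).
    by rewrite term0// powR_ge0.
  rewrite ge0_ler_powR ?(ltW p0) ?nnegrE// (fF (u.2 * s)%g)// subr0 (ger0_norm (f0 _)).
  have := lamp_lift_le u; have := lamp_lift_ge0 u.
  have := lamp_lift_le ((u : L) * ((x, 1%g) : L))%g; rewrite /= mulg1.
  have := lamp_lift_ge0 ((u : L) * ((x, 1%g) : L))%g.
  by rewrite ler_norml; lra.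
- have [us|/not_implyP[uF /negP usF]] := pselect (u.2 \in F -> (u.2 * s)%g \in F).
    by rewrite term0// eqxx.
  move=> ne0; rewrite !inE uF/=; apply: contraTT ne0; rewrite negb_or => /andP[uA uxA].
  rewrite negbK /lamp_lift /= (negbTE uA) ifF ?subrr ?normr0 ?powR0//.
  apply/negbTE; apply: contra uxA => uxA; apply/imfsetP.
  by exists (u.1 * lamps_act L u.2 x)%g; rewrite //= mulgK.
- rewrite /A cardfsU (leq_trans (leq_subr _ _))// mul2n -addnn leq_add2l.
  exact: leq_imfset_card.
Qed.

End UpperBound.

(** Used where [Folnerp p SH] is infinite: [fine] then yields 0, and the lamp factor 1 keeps the
    product infinite. *)
Lemma lamp_growth0 (H : groupType) (L : halo_product H) (Lam : nat -> nat) :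
  lamp_growth L Lam -> Lam 0%N = 1%N.
Proof.
move=> /(_ fset0); rewrite cardfs0 => <-; rewrite /block_card.
have -> : [set` (fset0 : {fset H})] = set0 by apply/seteqP; split => h.
by rewrite (halo0 (block_halo L)) fset_set1 cardfs1.
Qed.

(** The lift of a minimizer f at [C * x] is a competitor at x. Its support lies in L(F) x F, whose
    cardinality is the right-hand side because Lam(#|F|) = #|L(F)|. *)
Lemma Folnerp_halo_le (R : realType) (p : R) (H : groupType) (SH : {fset H})
    (L : halo_product H) (SL : {fset L}) (Lam : nat -> nat) :
  1 <= p -> naturally_generated L SH -> finite_blocks L -> lamp_growth L Lam ->
  asymp_le (Folnerp p SL)
    (fun x : R => (Folnerp p SH x *
       (Lam (Num.truncn (1 * fine (Folnerp p SH x))))%:R%:E)%E).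
Proof.
move=> p1 genL blocks growth; have p0 : 0 < p by lra.
have [|w [K K0 [wL wE]]] := energy_generated_seq p (@natural_generators H L SH) SL p0.
  by move=> u _; rewrite genL.
(* The energy of the lift over [SL] is at most D #|L(F)| times that of f over [SH]: each of the
   [size w] natural generators contributes a factor at most 2. Adding 1 gives C >= 1, so that D <= C
   <= C^p. *)
pose D := K * (size w)%:R * 2; have D0 : 0 <= D by rewrite !mulr_ge0.
pose C := D + 1; have C0 : 0 < C by rewrite ltr_wpDl.
exists C => //; exists 1 => //; exists 0; split => // x x0.
have y0 : 0 < C * x by rewrite mulr_gt0.
rewrite mul1e.
have [[_ infE]|[f [[f0 f_neq0 fC] infE _]]] := ereal_inf_natP R _
    [set f : {fsfun H -> R with 0} | [/\ forall g, 0 <= f g, finsupp f != fset0 &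
      lp_grad SH p f / lp_norm p f <= 1 / (C * x)]] (fun f => #|` finsupp f|).
  by rewrite [Folnerp p SH (C * x)]infE /= mulr0 truncn0 (lamp_growth0 _ _ _ growth) mule1 leey.
rewrite [Folnerp p SH (C * x)]infE /= mul1r natrK -EFinM -natrM -growth.
set F := finsupp f; pose X := (lamp_block L F `*` F : {fset L})%fset.
have fF : supported f F by move=> g; exact: fsfun_dflt.
have ex : exists g, f g != 0.
  by have /fset0Pn[g] := f_neq0; rewrite mem_finsupp => gf; exists g.
rewrite (Folnerp_ratio _ _ _ _ _ p0 y0 f0 fF ex) in fC.
pose phi : {fsfun L -> R with 0} := [fsfun g in X => lamp_lift L f F g].
have phiX : supported (lamp_lift L f F) X by exact: lamp_lift_supp.
have phiE : phi = lamp_lift L f F :> (L -> R).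
  by apply/funext => g; rewrite fsfunE; case: ifPn => // /phiX ->.
have phi_ex : exists g, lamp_lift L f F g != 0.
  have [h fh] := ex; exists (1%g, h).
  by rewrite /lamp_lift /= lamp_blockE// block1.
have phi_supp : (finsupp phi `<=` X)%fset.
  by apply/fsubsetP => g; rewrite mem_finsupp phiE; apply: contraNT => /phiX->.
apply: (@le_trans _ _ (#|` finsupp phi|%:R%:E)); last first.
  rewrite lee_fin ler_nat (leq_trans (fsubset_leq_card phi_supp))//.
  by rewrite cardfsM mulnC.
apply: ereal_inf_lbound; exists phi => //; rewrite /= phiE; split.
- exact: lamp_lift_ge0.
- have [g phig] := phi_ex; apply/fset0Pn; exists g.
  by rewrite mem_finsupp phiE.
rewrite (Folnerp_ratio _ _ _ _ X)//; last exact: lamp_lift_ge0.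
rewrite lamp_lift_norm; set E := \sum_(s <- SH) energy p s f in fC.
have wle v : v \in w ->
    energy p v (lamp_lift L f F) <= (2 * #|` lamp_block L F|)%:R * E.
  have sum_ge s : s \in SH -> energy p s f <= E.
    move=> sS; rewrite /E (big_fsetD1 s)//= lerDl sumr_ge0// => t _.
    exact: energy_ge0.
  move=> /wL [[s /= sS <-]|[s /= sS [y yb <-]]].
    apply: le_trans (energy_lamp_lift_base L p f F p0 fF s) _.
    rewrite ler_pM ?energy_ge0 ?sum_ge// ler_nat leq_pmull//.
  apply: le_trans (energy_lamp_lift_lamp L p f F p0 f0 fF blocks s y _) _.
    by rewrite inE.
  by rewrite ler_wpM2l ?sum_ge.
have := wE _ _ phiX.
set N := \sum_(h <- F) _ in fC *; set l := #|` lamp_block L F| => le1.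
have le2 : \sum_(v <- w) energy p v (lamp_lift L f F) <= (size w)%:R * ((2 * l)%:R * E).
  rewrite mulr_natl -iter_addr_0 -count_predT -big_const_seq.
  by rewrite big_seq [leRHS]big_seq; apply: ler_sum => v /wle.
have E0 : 0 <= E by rewrite sumr_ge0// => s _; exact: energy_ge0.
have xp0 : 0 <= x `^ p by exact: powR_ge0.
apply: (@le_trans _ _ (l%:R * ((C * x) `^ p * E))); last by rewrite ler_wpM2l.
rewrite powRM ?(ltW C0) ?(ltW x0)//.
apply: (@le_trans _ _ (x `^ p * (l%:R * (D * E)))).
  rewrite ler_wpM2l// (le_trans le1)// (le_trans (ler_wpM2l K0 le2))//.
  by rewrite natrM /D le_eqVlt; apply/orP; left; apply/eqP; ring.
have -> : l%:R * (C `^ p * x `^ p * E) = x `^ p * (l%:R * (C `^ p * E)) by ring.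
rewrite !ler_wpM2l// ler_wpM2r// (@le_trans _ _ C)//; first by rewrite lerDl.
by rewrite le1r_powR// lerDr.
Qed.

Theorem theoremD (R : realType) (p : R) (H : groupType) (SH : {fset H})
    (L : halo_product H) (SL : {fset L}) :
  1 <= p ->
  amenable R H ->
  generates SH ->
  naturally_generated L SH ->
  generates SL ->
  (large_scale_commutative L R SH ->
   finitely_generated_blocks L ->
   forall (s0 : H) (T : {fset subgroup_group (block L [set 1%g; s0])}),
     s0 \in SH -> generates T ->
     exists2 C : R, 0 < C &
       asymp_le (fun x : R => (Folner T x `^ (C * fine (Folner SH x))%R)%E)
                (Folnerp p SL))
  /\
  (consistent_blocks L ->
   forall Lam : nat -> nat, lamp_growth L Lam ->
     exists2 C : R, 0 < C &
       asymp_le (Folnerp p SL)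
         (fun x : R => (Folnerp p SH x *
            (Lam (Num.truncn (C * fine (Folnerp p SH x))))%:R%:E)%E)).
Proof.
move=> p1 amH _ genL genSL; split=> [_ _ s0 T _ _|[blocks _] Lam growth].
  by exists 24^-1; rewrite ?invr_gt0//; exact: Folner_power_le.
by exists 1 => //; exact: Folnerp_halo_le.
Qed.
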